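(* Let $n\ge 1$, let $A,B\in M_n(\mathbb{C})$ be positive semidefinite matrices, and let $f:[0,\infty)\to\mathbb{R}$ be any matrix monotone function. Then $$A f(A)+B f(B) \;\ge\; \left(\frac{A+B}{2}\right)^{1/2}\,\bigl(f(A)+f(B)\bigr)\,\left(\frac{A+B}{2}\right)^{1/2}.$$
   Context: $M_n(\mathbb{C})$ denotes the complex $n\times n$ matrices. For Hermitian matrices, $X\ge Y$ means that $X-Y$ is positive semidefinite; $X\ge 0$ means $X$ is positive semidefinite. For a positive semidefinite matrix $A$ and a real function $f$ on $[0,\infty)$, $f(A)$ is defined by the functional calculus (apply $f$ to the eigenvalues in a spectral decomposition); in particular $X^{1/2}$ is the positive semidefinite square root. A function $f:[0,\infty)\to\mathbb{R}$ is matrix monotone if it preserves the positive semidefinite ordering: for all positive semidefinite matrices $A,B$ of the same (arbitrary) size, $A\ge B$ implies $f(A)\ge f(B)$. *)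

(* Defs.v *)
From HB Require Import structures.
From mathcomp Require Import all_boot all_order all_algebra.
From mathcomp Require Import complex reals.

Set Implicit Arguments.
Unset Strict Implicit.
Unset Printing Implicit Defensive.

Import Order.TTheory GRing.Theory Num.Theory.

Local Open Scope ring_scope.
Local Open Scope complex_scope.
Local Open Scope sesquilinear_scope.

(* In R[i], 0 <= z means that z is real and nonnegative. *)
Definition psdmx (R : realType) (n : nat) (A : 'M[R[i]]_n) : Prop :=
  A \is hermsymmx /\ forall v : 'cV[R[i]]_n, 0 <= (v^t* *m A *m v) 0 0.

Definition loewner_ge (R : realType) (n : nat) (X Y : 'M[R[i]]_n) : Prop :=
  psdmx (X - Y).

(* The library's spectral decomposition of a normal matrix reads
   A = P^-1 diag(d) P with P = spectralmx A unitary and d = spectral_diag A.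
   For Hermitian A the entries of d are real, so taking real parts loses
   nothing; for positive semidefinite A only values of f on [0, +oo) are used.
   fun_mxE shows that the result does not depend on the decomposition. *)
Definition fun_mx (R : realType) (f : R -> R) (n : nat) (A : 'M[R[i]]_n) :
    'M[R[i]]_n :=
  invmx (spectralmx A)
    *m diag_mx (map_mx (fun z : R[i] => (f (complex.Re z))%:C) (spectral_diag A))
    *m spectralmx A.

Definition sqrt_mx (R : realType) (n : nat) (A : 'M[R[i]]_n) : 'M[R[i]]_n :=
  fun_mx (@Num.sqrt R) A.

(* A function on [0, +oo) is represented by a total f : R -> R; its values at
   negative reals are irrelevant. *)
Definition matrix_monotone (R : realType) (f : R -> R) : Prop :=
  forall (n : nat) (A B : 'M[R[i]]_n), psdmx A -> psdmx B ->
    loewner_ge A B -> loewner_ge (fun_mx f A) (fun_mx f B).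

Lemma fun_mxE (R : realType) (f : R -> R) (n : nat) (P : 'M[R[i]]_n)
    (d : 'rV[R]_n) :
  P \is unitarymx ->
  fun_mx f (P^t* *m diag_mx (map_mx (fun x : R => x%:C) d) *m P) =
  P^t* *m diag_mx (map_mx (fun x => (f x)%:C) d) *m P.
Proof.
move=> Pu; pose D := map_mx (fun x : R => x%:C) d.
set A := (X in fun_mx f X).
have PK : P *m P^t* = 1%:M by apply/unitarymxP.
have KP : P^t* *m P = 1%:M by apply: mulmx1C.
have Anormal : A \is normalmx.
  apply/normalmxP; rewrite /A !trmx_mul !map_mxM/= trmxCK -!mulmxA.
  rewrite !(mulmxA P) PK !mul1mx; congr (_ *m _); rewrite !mulmxA.
  by rewrite tr_diag_mx map_diag_mx/= !mulmx_diag; congr (diag_mx _ *m _);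
    apply/rowP => j; rewrite !mxE mulrC.
have Qu := spectral_unit A.
have /orthomx_spectralP EA := Anormal.
rewrite /fun_mx; move: (spectralmx A) (spectral_diag A) Qu EA => Q e Qu EA.
pose U := Q *m P^t*.
have UE : U *m diag_mx D = diag_mx e *m U.
  transitivity (Q *m A *m P^t*); first by rewrite /A -/D /U -!mulmxA PK mulmx1.
  by rewrite {1}EA /U !mulmxA mulmxV // mul1mx.
have UfE : U *m diag_mx (map_mx (fun x => (f x)%:C) d) =
    diag_mx (map_mx (fun z : R[i] => (f (complex.Re z))%:C) e) *m U.
  apply/matrixP => i j; move/matrixP/(_ i j): UE.
  rewrite !mul_mx_diag !mul_diag_mx !mxE [LHS]mulrC => Eij.
  have [->|Unz] := eqVneq (\sum_j0 Q i j0 * (P^t*) j0 j) 0.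
    by rewrite mul0r mulr0.
  by rewrite -(mulIf Unz Eij) /= mulrC.
have QE : Q = U *m P by rewrite /U -mulmxA KP mulmx1.
rewrite [X in _ *m X]QE mulmxA -(mulmxA (invmx Q)) -UfE /U.
by rewrite !mulmxA mulVmx // mul1mx.
Qed.

(* Main.v *)
Require Import Defs.
From mathcomp Require Import all_boot all_order all_algebra.
From mathcomp Require Import complex reals.
From mathcomp Require Import ring.

Set Implicit Arguments.
Unset Strict Implicit.
Unset Printing Implicit Defensive.

Import Order.TTheory GRing.Theory Num.Theory.

Local Open Scope ring_scope.
Local Open Scope sesquilinear_scope.

(* Let V be an isometry with adjoint V', X >= 0 and M = V' X V.  For a matrix
   monotone f, (i) V' f(X) V <= f(M) and (ii) M f(M) <= V' X f(X) V.
   With P = V V' and Q = 1 - P, X <= (1 + t^2) P X P + (1 + t^-2) Q X Q, and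
   V intertwines the right-hand side with (1 + t^2) M, so that
   V' f(X) V <= f((1 + t^2) M); letting t tend to 0 gives (i).
   For (ii), put T = X^(1/2) V: then T T' <= X, hence
   T' f(X) T >= T' f(T T') T = M f(M).
   For X = diag(A, B) and V = 2^(-1/2) [1; 1], so that M = (A + B) / 2, this gives
   (A f(A) + B f(B)) / 2 >= M f(M) = M^(1/2) f(M) M^(1/2)
                         >= M^(1/2) (f(A) + f(B)) / 2 M^(1/2). *)

(* Over R[i], the next three definitions are convertible to psdmx, fun_mx (for
   f \o Re) and matrix_monotone. *)
Definition psd (C : numClosedFieldType) (n : nat) (A : 'M[C]_n) : Prop :=
  A \is hermsymmx /\ forall v : 'cV[C]_n, 0 <= (v^t* *m A *m v) 0 0.

Definition mxfun (C : numClosedFieldType) (f : C -> C) (n : nat)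
    (A : 'M[C]_n) : 'M[C]_n :=
  invmx (spectralmx A) *m diag_mx (map_mx f (spectral_diag A))
    *m spectralmx A.

Definition mxmonotone (C : numClosedFieldType) (f : C -> C) : Prop :=
  forall (n : nat) (A B : 'M[C]_n), psd A -> psd B ->
    psd (A - B) -> psd (mxfun f A - mxfun f B).

(** * Conjugate transpose, Hermitian and unitary matrices *)

Lemma trmxC_mul (C : numClosedFieldType) (m n p : nat) (A : 'M[C]_(m, n))
    (B : 'M[C]_(n, p)) :
  (A *m B)^t* = B^t* *m A^t*.
Proof. by rewrite trmx_mul map_mxM. Qed.

Lemma trmxCD (C : numClosedFieldType) (m n : nat) (A B : 'M[C]_(m, n)) :
  (A + B)^t* = A^t* + B^t*.
Proof. by rewrite linearD map_mxD. Qed.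

Lemma trmxCB (C : numClosedFieldType) (m n : nat) (A B : 'M[C]_(m, n)) :
  (A - B)^t* = A^t* - B^t*.
Proof. by rewrite linearB map_mxB. Qed.

Lemma trmxCZ (C : numClosedFieldType) (m n : nat) (a : C) (A : 'M[C]_(m, n)) :
  a \is Num.real -> (a *: A)^t* = a *: A^t*.
Proof. by move=> ra; rewrite linearZ map_mxZ /= conj_Creal. Qed.

Lemma trmxC1 (C : numClosedFieldType) (n : nat) : (1%:M : 'M[C]_n)^t* = 1%:M.
Proof. by rewrite trmx1 map_mx1. Qed.

Lemma hermsymmxP (C : numClosedFieldType) (n : nat) (A : 'M[C]_n) :
  reflect (A^t* = A) (A \is hermsymmx).
Proof.
apply: (iffP (is_hermitianmxP _ _ _)); rewrite expr0 scale1r => H; exact: esym.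
Qed.

Lemma unitaryCmx (C : numClosedFieldType) (n : nat) (P : 'M[C]_n) :
  P \is unitarymx -> P^t* *m P = 1%:M.
Proof. by move=> /unitarymxP PK; apply: mulmx1C. Qed.

(** * Functional calculus of Hermitian matrices *)

Lemma herm_spectralP (C : numClosedFieldType) (n : nat) (A : 'M[C]_n) :
  A \is hermsymmx ->
  exists (P : 'M[C]_n) (d : 'rV[C]_n), [/\ P \is unitarymx,
    forall j, d 0 j \is Num.real, A = P^t* *m diag_mx d *m P &
    forall f, mxfun f A = P^t* *m diag_mx (map_mx f d) *m P].
Proof.
move=> hA; exists (spectralmx A), (spectral_diag A).
have Pu := spectral_unitarymx A; split => //.
- by move=> j; have /mxOverP := hermitian_spectral_diag_real hA; apply.
- have /orthomx_spectralP {1}-> := hermitian_normalmx hA.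
  by rewrite invmx_unitary.
- by move=> f; rewrite /mxfun invmx_unitary.
Qed.

(** In eigenbases the equation reads [d_i S_ij = S_ij e_j] with [S = P T Q^t*]: an entry [S_ij] is
    nonzero only where [d_i = e_j], and there [f] takes equal values. [T] may be rectangular, which
    lets [f] pass through an isometry. *)
Lemma spectral_intertwine (C : numClosedFieldType) (f : C -> C) (m n : nat)
    (P : 'M[C]_m) (Q : 'M[C]_n) (d : 'rV[C]_m) (e : 'rV[C]_n)
    (T : 'M[C]_(m, n)) :
  P \is unitarymx -> Q \is unitarymx ->
  P^t* *m diag_mx d *m P *m T = T *m (Q^t* *m diag_mx e *m Q) ->
  P^t* *m diag_mx (map_mx f d) *m P *m T =
  T *m (Q^t* *m diag_mx (map_mx f e) *m Q).
Proof.
move=> Pu Qu E.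
have [KP PK] := (unitaryCmx Pu, unitarymxP Pu).
have [KQ QK] := (unitaryCmx Qu, unitarymxP Qu).
pose S := P *m T *m Q^t*.
have TE : T = P^t* *m S *m Q.
  by rewrite /S !mulmxA KP mul1mx -mulmxA KQ mulmx1.
have SE : diag_mx d *m S = S *m diag_mx e.
  move/(congr1 (fun Z => P *m Z *m Q^t*)): E; rewrite /S !mulmxA PK !mul1mx.
  by move=> ->; rewrite -!mulmxA QK mulmx1.
clearbody S; suff SfE : diag_mx (map_mx f d) *m S = S *m diag_mx (map_mx f e).
  rewrite TE -!mulmxA (mulmxA P) PK mul1mx (mulmxA Q) QK mul1mx.
  by rewrite (mulmxA _ S) SfE -!mulmxA.
apply/matrixP => i j; move/matrixP/(_ i j): SE.
rewrite !mul_mx_diag !mul_diag_mx !mxE [RHS]mulrC => Eij.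
have [->|Snz] := eqVneq (S i j) 0; first by rewrite mulr0 mul0r.
by rewrite (mulIf Snz Eij) mulrC.
Qed.

Lemma diag_mx_herm (C : numClosedFieldType) (n : nat) (d : 'rV[C]_n) :
  (forall j, d 0 j \is Num.real) -> diag_mx d \is hermsymmx.
Proof.
move=> d_real; apply/hermsymmxP; rewrite tr_diag_mx map_diag_mx.
by congr diag_mx; apply/rowP => j; rewrite !mxE /= conj_Creal.
Qed.

Lemma congr_herm (C : numClosedFieldType) (m n : nat) (A : 'M[C]_m)
    (T : 'M[C]_(m, n)) :
  A \is hermsymmx -> T^t* *m A *m T \is hermsymmx.
Proof.
move=> /hermsymmxP hA.
by apply/hermsymmxP; rewrite !trmxC_mul trmxCK hA mulmxA.
Qed.

(** Intertwining with [T = 1] compares the given decomposition with the one chosen by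
    [spectralmx]. *)
Lemma mxfunE (C : numClosedFieldType) (f : C -> C) (n : nat) (P : 'M[C]_n)
    (d : 'rV[C]_n) :
  P \is unitarymx -> (forall j, d 0 j \is Num.real) ->
  mxfun f (P^t* *m diag_mx d *m P) = P^t* *m diag_mx (map_mx f d) *m P.
Proof.
move=> Pu d_real; have := congr_herm P (diag_mx_herm d_real).
move=> /herm_spectralP[Q [e [Qu _ E ->]]].
rewrite -[LHS]mulmx1 -[RHS]mul1mx; apply: spectral_intertwine => //.
by rewrite -E mulmx1 mul1mx.
Qed.

Lemma mxfun_intertwine (C : numClosedFieldType) (f : C -> C) (m n : nat)
    (X : 'M[C]_m) (Y : 'M[C]_n) (T : 'M[C]_(m, n)) :
  X \is hermsymmx -> Y \is hermsymmx ->
  X *m T = T *m Y -> mxfun f X *m T = T *m mxfun f Y.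
Proof.
move=> /herm_spectralP[P [d [Pu _ EX ->]]] /herm_spectralP[Q [e [Qu _ EY ->]]].
by rewrite {}EX {}EY; apply: spectral_intertwine.
Qed.

Lemma mxfun_herm (C : numClosedFieldType) (f : C -> C) (n : nat) (A : 'M[C]_n) :
  (forall x, f x \is Num.real) -> A \is hermsymmx -> mxfun f A \is hermsymmx.
Proof.
move=> f_real /herm_spectralP[P [d [_ _ _ ->]]].
by apply/congr_herm/diag_mx_herm => j; rewrite mxE.
Qed.

Lemma mxfun_id (C : numClosedFieldType) (n : nat) (A : 'M[C]_n) :
  A \is hermsymmx -> mxfun id A = A.
Proof.
by move=> /herm_spectralP[P [d [_ _ AE ->]]]; rewrite (map_mx_id (f := id)).
Qed.

Lemma mxfunM (C : numClosedFieldType) (f g : C -> C) (n : nat) (A : 'M[C]_n) :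
  A \is hermsymmx ->
  mxfun f A *m mxfun g A = mxfun (fun x => f x * g x) A.
Proof.
move=> /herm_spectralP[P [d [Pu _ _ fE]]]; rewrite !fE.
rewrite -!mulmxA (mulmxA P) (unitarymxP Pu) mul1mx (mulmxA (diag_mx _)).
rewrite mulmx_diag; congr (_ *m (diag_mx _ *m _)).
by apply/rowP => j; rewrite !mxE.
Qed.

Lemma mxfun_lin (C : numClosedFieldType) (f g : C -> C) (a : C) (n : nat)
    (A : 'M[C]_n) :
  A \is hermsymmx ->
  mxfun (fun x => f x + a * g x) A = mxfun f A + a *: mxfun g A.
Proof.
move=> /herm_spectralP[P [d [_ _ _ fE]]]; rewrite !fE.
rewrite scalemxAl scalemxAr -mulmxDl -mulmxDr -linearZ -linearD.
by congr (_ *m diag_mx _ *m _); apply/rowP => j; rewrite !mxE.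
Qed.

Lemma mxfunZ (C : numClosedFieldType) (f : C -> C) (a : C) (n : nat)
    (A : 'M[C]_n) :
  a \is Num.real -> A \is hermsymmx ->
  mxfun f (a *: A) = mxfun (fun x => f (a * x)) A.
Proof.
move=> a_real /herm_spectralP[P [d [Pu d_real -> fE]]].
rewrite scalemxAl scalemxAr -linearZ !mxfunE//; last first.
  by move=> j; rewrite mxE realM.
by congr (_ *m diag_mx _ *m _); apply/rowP => j; rewrite !mxE.
Qed.

Lemma mxfun_scalar (C : numClosedFieldType) (f : C -> C) (n : nat) (a : C) :
  a \is Num.real -> mxfun f (a%:M : 'M[C]_n) = (f a)%:M.
Proof.
move=> a_real; have := @mxfunE C f n 1%:M (const_mx a).
rewrite !map_const_mx !diag_const_mx trmxC1 !mul1mx !mulmx1; apply.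
  by apply/unitarymxP; rewrite trmxC1 mulmx1.
by move=> j; rewrite mxE.
Qed.

(** * Positive semidefinite matrices *)

Lemma psd_herm (C : numClosedFieldType) (n : nat) (A : 'M[C]_n) :
  psd A -> A \is hermsymmx.
Proof. by case. Qed.

Lemma psdD (C : numClosedFieldType) (n : nat) (A B : 'M[C]_n) :
  psd A -> psd B -> psd (A + B).
Proof.
move=> [/hermsymmxP hA pA] [/hermsymmxP hB pB]; split.
  by apply/hermsymmxP; rewrite trmxCD hA hB.
by move=> v; rewrite mulmxDr mulmxDl mxE addr_ge0.
Qed.

Lemma psd_congr (C : numClosedFieldType) (m n : nat) (A : 'M[C]_m)
    (T : 'M[C]_(m, n)) :
  psd A -> psd (T^t* *m A *m T).
Proof.
move=> [hA pA]; split; first exact: congr_herm.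
by move=> v; have := pA (T *m v); rewrite trmxC_mul !mulmxA.
Qed.

Lemma psd_diag (C : numClosedFieldType) (n : nat) (d : 'rV[C]_n) :
  (forall j, 0 <= d 0 j) -> psd (diag_mx d).
Proof.
move=> d_ge0; split; first by apply: diag_mx_herm => j; apply: ger0_real.
move=> v; rewrite mul_mx_diag mxE; apply: sumr_ge0 => j _.
by rewrite !mxE mulrAC mulr_ge0// mulrC mul_conjC_ge0.
Qed.

Lemma psd_scalar (C : numClosedFieldType) (n : nat) (a : C) :
  0 <= a -> psd (a%:M : 'M[C]_n).
Proof.
by move=> a_ge0; rewrite -diag_const_mx; apply: psd_diag => j; rewrite mxE.
Qed.

Lemma psdZ (C : numClosedFieldType) (n : nat) (a : C) (A : 'M[C]_n) :
  0 <= a -> psd A -> psd (a *: A).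
Proof.
move=> a_ge0 [/hermsymmxP hA pA]; split.
  by apply/hermsymmxP; rewrite trmxCZ ?hA// ger0_real.
by move=> v; rewrite -scalemxAr -scalemxAl mxE mulr_ge0.
Qed.

Lemma psd_gram (C : numClosedFieldType) (m n : nat) (T : 'M[C]_(m, n)) :
  psd (T^t* *m T).
Proof. by rewrite -[T^t*]mulmx1; apply/psd_congr/psd_scalar. Qed.

Lemma psd_spectralP (C : numClosedFieldType) (n : nat) (A : 'M[C]_n) :
  psd A ->
  exists (P : 'M[C]_n) (d : 'rV[C]_n), [/\ P \is unitarymx,
    forall j, 0 <= d 0 j, A = P^t* *m diag_mx d *m P &
    forall f, mxfun f A = P^t* *m diag_mx (map_mx f d) *m P].
Proof.
move=> [/herm_spectralP[P [d [Pu d_real AE fE]]] pA].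
(* The j-th column of [P^t*] is an eigenvector; testing on it isolates [d 0 j]. *)
exists P, d; split => // j; have := pA (P^t* *m delta_mx j 0).
rewrite AE trmxC_mul trmxCK !mulmxA.
rewrite -!(mulmxA _ P (P^t*)) (unitarymxP Pu) !mulmx1.
rewrite trmx_delta map_delta_mx -rowE -colE !mxE.
by rewrite eqxx mulr1n.
Qed.

Lemma mxfun_eq (C : numClosedFieldType) (f g : C -> C) (n : nat) (A : 'M[C]_n) :
  (forall x, 0 <= x -> f x = g x) -> psd A -> mxfun f A = mxfun g A.
Proof.
move=> fg /psd_spectralP[P [d [_ d_ge0 _ fE]]]; rewrite !fE.
by congr (_ *m diag_mx _ *m _); apply/rowP => j; rewrite !mxE fg.
Qed.

Lemma mxfun_psd (C : numClosedFieldType) (f : C -> C) (n : nat) (A : 'M[C]_n) :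
  (forall x, 0 <= x -> 0 <= f x) -> psd A -> psd (mxfun f A).
Proof.
move=> f_ge0 /psd_spectralP[P [d [_ d_ge0 _ ->]]].
by apply/psd_congr/psd_diag => j; rewrite mxE f_ge0.
Qed.

(** * Compression by an isometry *)

(** The matrix [1 - V V^t*] is a Hermitian idempotent, hence its own Gram matrix. *)
Lemma psd_compl_isometry (C : numClosedFieldType) (m n : nat)
    (V : 'M[C]_(m, n)) :
  V^t* *m V = 1%:M -> psd (1%:M - V *m V^t*).
Proof.
move=> VV; have QQ := psd_gram (1%:M - V *m V^t*); move: QQ.
rewrite trmxCB trmxC1 trmxC_mul trmxCK mulmxBr mulmx1 mulmxBl mul1mx.
by rewrite mulmxA -(mulmxA V) VV mulmx1 subrr subr0.
Qed.

(* With Q = 1 - P, the difference is K X K for the Hermitian K = t P - t^-1 Q. *)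
Lemma psd_pinching_bound (C : numClosedFieldType) (m : nat) (t : C)
    (X P : 'M[C]_m) :
  0 < t -> psd X -> P^t* = P ->
  psd ((1 + t ^+ 2) *: (P *m X *m P) +
    (1 + t ^- 2) *: ((1%:M - P) *m X *m (1%:M - P)) - X).
Proof.
move=> t_gt0 pX hP; set Q := 1%:M - P.
have hQ : Q^t* = Q by rewrite trmxCB trmxC1 hP.
have PQ : P + Q = 1%:M by rewrite addrC subrK.
clearbody Q; have t_real : t \is Num.real := gtr0_real t_gt0.
have := psd_congr (t *: P - t^-1 *: Q) pX.
rewrite trmxCB !trmxCZ ?realV// hP hQ.
rewrite !mulmxBl !mulmxBr -!scalemxAl -!scalemxAr.
(* In [K X K] the cross terms [P X Q] and [Q X P] have coefficient [- t t^-1 = -1], exactly what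
   subtracting [X] leaves. *)
have XE : X = P *m X *m P + P *m X *m Q + Q *m X *m P + Q *m X *m Q.
  by rewrite -addrA -!mulmxDr PQ !mulmx1 -mulmxDl PQ mul1mx.
congr psd; rewrite [in X in _ = _ - X]XE.
move: (P *m X *m P) (P *m X *m Q) (Q *m X *m P) (Q *m X *m Q) => a b c d.
by apply/matrixP => i j; rewrite !mxE; field; rewrite gt_eqF.
Qed.

(** The coefficient [1 + t^-2] of the dominating matrix blows up as [t] tends to 0, but it only
    meets [(1 - P) V = 0]. What remains of [t] is a dilation of the argument by [1 + t^2], removed
    in [mxmonotone_compress]. *)
Lemma mxmonotone_compress_approx (C : numClosedFieldType) (f : C -> C)
    (m n : nat) (t : C)
    (X : 'M[C]_m) (V : 'M[C]_(m, n)) :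
  mxmonotone f -> 0 < t -> psd X -> V^t* *m V = 1%:M ->
  psd (mxfun f ((1 + t ^+ 2) *: (V^t* *m X *m V)) - V^t* *m mxfun f X *m V).
Proof.
move=> f_mono t_gt0 pX VV; set Y := _ *: _; pose P := V *m V^t*.
have PV : P *m V = V by rewrite /P -mulmxA VV mulmx1.
have hP : P^t* = P by rewrite /P trmxC_mul trmxCK.
have := psd_pinching_bound t_gt0 pX hP; set Z := _ *: _ + _ *: _ => pZX.
have pZ : psd Z by rewrite -(subrK X Z); apply: psdD.
have pY : psd Y.
  by apply: psdZ (psd_congr _ pX); rewrite addr_ge0// exprn_ge0// ltW.
have ZV : Z *m V = V *m Y.
  have QV : (1%:M - P) *m V = 0 by rewrite mulmxBl mul1mx PV subrr.
  rewrite mulmxDl -!scalemxAl -(mulmxA _ P V) PV.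
  rewrite -(mulmxA _ (1%:M - P) V) QV mulmx0 scaler0 addr0.
  by rewrite /Y -scalemxAr /P !mulmxA.
have fZV := mxfun_intertwine f (psd_herm pZ) (psd_herm pY) ZV.
have := psd_congr V (f_mono _ _ _ pZ pX pZX).
by rewrite mulmxBr mulmxBl -(mulmxA _ (mxfun f Z)) fZV mulmxA VV mul1mx.
Qed.

Lemma psd_sqrtC (C : numClosedFieldType) (n : nat) (X : 'M[C]_n) :
  psd X -> exists S : 'M[C]_n, [/\ S^t* = S, S *m S = X &
    forall f, S *m mxfun f X = mxfun f X *m S].
Proof.
move=> pX; exists (mxfun sqrtC X); split.
- by apply/hermsymmxP/psd_herm/mxfun_psd => // x; rewrite sqrtC_ge0.
- rewrite mxfunM ?psd_herm// -[RHS]mxfun_id ?psd_herm//.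
  by apply: mxfun_eq => // x _; rewrite -expr2 sqrtCK.
- move=> f; rewrite !mxfunM ?psd_herm//.
  by apply: mxfun_eq => // x _; rewrite mulrC.
Qed.

(* For T = X^(1/2) V, T T' <= X, and T intertwines T T' with T' T = V' X V. *)
Lemma mxmonotone_mulx_compress (C : numClosedFieldType) (f : C -> C) (m n : nat)
    (X : 'M[C]_m) (V : 'M[C]_(m, n)) :
  mxmonotone f -> psd X -> V^t* *m V = 1%:M ->
  psd (V^t* *m (X *m mxfun f X) *m V -
    (V^t* *m X *m V) *m mxfun f (V^t* *m X *m V)).
Proof.
move=> f_mono pX VV; set M := V^t* *m X *m V.
have pM : psd M by apply: psd_congr.
have [S [hS SS Sf]] := psd_sqrtC pX.
pose T := S *m V.
have TT : T^t* *m T = M by rewrite trmxC_mul hS /M -SS !mulmxA.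
have pTT : psd (T *m T^t*) by rewrite -{1}[T]trmxCK; apply: psd_gram.
have pXTT : psd (X - T *m T^t*).
  have := psd_congr S (psd_compl_isometry VV).
  by rewrite hS mulmxBr mulmx1 mulmxBl SS /T trmxC_mul hS !mulmxA.
have TTT : T *m T^t* *m T = T *m M by rewrite -mulmxA TT.
have := psd_congr T (f_mono _ _ _ pX pTT pXTT).
rewrite mulmxBr mulmxBl.
rewrite -(mulmxA _ (mxfun f (T *m T^t*))).
rewrite (mxfun_intertwine f (psd_herm pTT) (psd_herm pM) TTT) mulmxA TT.
have fXX : mxfun f X *m X = X *m mxfun f X.
  exact: mxfun_intertwine (psd_herm pX) (psd_herm pX) _.
(* [S] commutes with [f(X)], so the two factors [S] coming from [T] merge into [X]. *)
suff -> : T^t* *m mxfun f X *m T = V^t* *m (X *m mxfun f X) *m V by [].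
move: (mxfun f X) (Sf f) fXX => F SF FX; rewrite /T trmxC_mul hS !mulmxA.
rewrite -(mulmxA _ S F) SF !mulmxA -(mulmxA _ S S) SS.
by rewrite -(mulmxA _ F) FX !mulmxA.
Qed.

(** * Block diagonal matrices and their weighted compressions *)

Lemma block_diag_psd (C : numClosedFieldType) (m n : nat) (A : 'M[C]_m)
    (B : 'M[C]_n) :
  psd A -> psd B -> psd (block_mx A 0 0 B).
Proof.
move=> [/hermsymmxP hA pA] [/hermsymmxP hB pB]; split.
  by apply/hermsymmxP; rewrite tr_block_mx map_block_mx !trmx0 !map_mx0 hA hB.
move=> v; rewrite -[v]vsubmxK tr_col_mx map_row_mx -mulmxA mul_block_col.
by rewrite !mul0mx addr0 add0r mul_row_col mxE addr_ge0// mulmxA.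
Qed.

(** Each block column of the identity intertwines the block matrix with [A] or with [B]; the two
    resulting columns are glued. *)
Lemma mxfun_block_diag (C : numClosedFieldType) (f : C -> C) (m n : nat)
    (A : 'M[C]_m) (B : 'M[C]_n) :
  psd A -> psd B ->
  mxfun f (block_mx A 0 0 B) = block_mx (mxfun f A) 0 0 (mxfun f B).
Proof.
move=> pA pB; have /psd_herm hX := block_diag_psd pA pB.
rewrite -[LHS]mulmx1 scalar_mx_block [block_mx 1%:M _ _ _]block_mxEh mul_mx_row.
rewrite (mxfun_intertwine f (T := col_mx 1%:M 0) hX (psd_herm pA)); last first.
  by rewrite mul_block_col mul_col_mx !mulmx0 !mul0mx !addr0 mulmx1 mul1mx.
rewrite (mxfun_intertwine f (T := col_mx 0 1%:M) hX (psd_herm pB)); last first.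
  by rewrite mul_block_col mul_col_mx !mulmx0 !mul0mx !add0r mulmx1 mul1mx.
by rewrite !mul_col_mx !mul1mx !mul0mx -block_mxEh.
Qed.

(** Square roots make the compression of [diag(A, B)] the combination with weights [p] and [q].
    Weights 1/2, 1/2 serve the final inequality; [1 - e], [e] serve the scalar estimate. *)
Definition wcol (C : numClosedFieldType) (n : nat) (p q : C) :
    'M[C]_(n + n, n) :=
  col_mx (sqrtC p)%:M (sqrtC q)%:M.

Lemma wcol_compress (C : numClosedFieldType) (n : nat) (p q : C)
    (A B : 'M[C]_n) :
  0 <= p -> 0 <= q ->
  (wcol n p q)^t* *m block_mx A 0 0 B *m wcol n p q = p *: A + q *: B.
Proof.
move=> p_ge0 q_ge0; rewrite /wcol tr_col_mx map_row_mx !tr_scalar_mx.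
rewrite !map_scalar_mx /= !conj_Creal ?ger0_real ?sqrtC_ge0//.
rewrite mul_row_block !mulmx0 addr0 add0r mul_row_col !mul_scalar_mx.
by rewrite !mul_mx_scalar !scalerA -!expr2 !sqrtCK.
Qed.

Lemma wcol_isometry (C : numClosedFieldType) (n : nat) (p q : C) :
  0 <= p -> 0 <= q -> p + q = 1 -> (wcol n p q)^t* *m wcol n p q = 1%:M.
Proof.
move=> p_ge0 q_ge0 pq.
have := wcol_compress (1%:M : 'M[C]_n) 1%:M p_ge0 q_ge0.
by rewrite -scalar_mx_block mulmx1 -scalerDl pq scale1r.
Qed.

(** * Scalar estimates and the limit *)

Lemma psd_scalar1 (C : numClosedFieldType) (a : C) :
  psd (a%:M : 'M[C]_1) -> 0 <= a.
Proof.
by move=> [_ /(_ 1%:M)]; rewrite trmxC1 mul1mx mulmx1 mxE mulr1n.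
Qed.

Lemma mxmonotone_homo (C : numClosedFieldType) (f : C -> C) (x y : C) :
  mxmonotone f -> 0 <= x -> x <= y -> f x <= f y.
Proof.
move=> f_mono x_ge0 xy; have y_ge0 := le_trans x_ge0 xy.
have := f_mono 1%N y%:M x%:M (psd_scalar _ y_ge0) (psd_scalar _ x_ge0).
rewrite -!raddfB /= !mxfun_scalar ?ger0_real// -raddfB -[f x <= _]subr_ge0.
by move=> H; apply/psd_scalar1/H/psd_scalar; rewrite subr_ge0.
Qed.

(* Apply mxmonotone_compress_approx to diag(b, 0), b = (1 + e) x, with weights
   1 - e and e: (1 + e^2) (1 - e) b = (1 - e^4) x <= x.  This replaces the
   continuity of f, which may fail at 0. *)
Lemma mxmonotone_dilate_le (C : numClosedFieldType) (f : C -> C) (e x : C) :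
  mxmonotone f -> 0 < e -> e <= 1 -> 0 <= x ->
  f ((1 + e) * x) <= f x + e * (f (2 * x) - f 0).
Proof.
move=> f_mono e_gt0 e_le1 x_ge0; have e_ge0 := ltW e_gt0.
have p_ge0 : 0 <= 1 - e by rewrite subr_ge0.
set b := (1 + e) * x.
have b_ge0 : 0 <= b by rewrite mulr_ge0// addr_ge0.
have pA := psd_scalar 1 b_ge0; have pB := psd_scalar 1 (lexx (0 : C)).
have := mxmonotone_compress_approx f_mono e_gt0 (block_diag_psd pA pB)
  (wcol_isometry 1 p_ge0 e_ge0 (subrK _ _)).
rewrite mxfun_block_diag// !wcol_compress// !mxfun_scalar ?ger0_real//.
rewrite !scale_scalar_mx -!raddfD /= scale_scalar_mx mxfun_scalar; last first.
  by rewrite ger0_real// mulr0 addr0 !mulr_ge0// addr_ge0// exprn_ge0.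
rewrite -raddfB => /psd_scalar1; rewrite subr_ge0 mulr0 addr0 => fb.
have fx : f ((1 + e ^+ 2) * ((1 - e) * b)) <= f x.
  apply: mxmonotone_homo => //.
    by rewrite !mulr_ge0// addr_ge0// exprn_ge0.
  have -> : (1 + e ^+ 2) * ((1 - e) * b) = x - e ^+ 4 * x by rewrite /b; ring.
  by rewrite gerBl mulr_ge0// exprn_ge0.
have f2x : f b <= f (2 * x).
  apply: mxmonotone_homo => //; apply: ler_wpM2r => //.
  by rewrite -[2]/(1 + 1) lerD2l.
(* The weighted average is at most [f x]; the remainder carries the factor [e] and is controlled by
   [b <= 2 x]. *)
have -> : f b = ((1 - e) * f b + e * f 0) + e * (f b - f 0) by ring.
apply: lerD; first exact: le_trans fb fx.
by apply: ler_wpM2l => //; rewrite lerD2r.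
Qed.

(** Take [t^2 = e] in the approximate bound. By the scalar estimate at each eigenvalue,
    [f((1 + e) M) <= f(M) + e g(M)] with [g x = f (2 x) - f 0], so the error is linear in [e] and
    vanishes in every quadratic form as [e] tends to 0. *)
Lemma mxmonotone_compress (C : numClosedFieldType) (f : C -> C) (m n : nat)
    (X : 'M[C]_m) (V : 'M[C]_(m, n)) :
  (forall x, f x \is Num.real) -> mxmonotone f ->
  psd X -> V^t* *m V = 1%:M ->
  psd (mxfun f (V^t* *m X *m V) - V^t* *m mxfun f X *m V).
Proof.
move=> f_real f_mono pX VV; set M := V^t* *m X *m V; set G := _ *m _ *m V.
have pM : psd M by apply: psd_congr.
have hM := psd_herm pM.
pose g x := f (2 * x) - f 0.
have pg : psd (mxfun g M).
  apply: mxfun_psd => // x x_ge0; rewrite subr_ge0.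
  by apply: mxmonotone_homo => //; rewrite mulr_ge0.
have approx (e : C) : 0 < e -> e <= 1 -> psd (mxfun f M - G + e *: mxfun g M).
  move=> e_gt0 e_le1; have t_gt0 : 0 < sqrtC e by rewrite sqrtC_gt0.
  have := mxmonotone_compress_approx f_mono t_gt0 pX VV.
  rewrite sqrtCK -/M -/G => pfG.
  have e1_real : 1 + e \is Num.real.
    by rewrite ger0_real// addr_ge0// ltW.
  have : psd (mxfun (fun x => f x + e * g x + (-1) * f ((1 + e) * x)) M).
    apply: mxfun_psd => // x x_ge0; rewrite mulN1r subr_ge0.
    exact: mxmonotone_dilate_le.
  rewrite 2!(mxfun_lin _ _ _ hM) scaleN1r -mxfunZ// => /psdD/(_ pfG).
  by rewrite addrA subrK addrAC.
split.
  apply/hermsymmxP; rewrite trmxCB (hermsymmxP _ (mxfun_herm f_real hM)).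
  have /hermsymmxP -> // := congr_herm V (mxfun_herm f_real (psd_herm pX)).
move=> v; set a := (_ *m _) 0 0.
have [_ /(_ v)] := pg; set k := (_ *m _) 0 0 => k_ge0.
have ak (e : C) : 0 < e -> e <= 1 -> 0 <= a + e * k.
  move=> e_gt0 e_le1; have [_ /(_ v)] := approx e e_gt0 e_le1.
  by rewrite mulmxDr mulmxDl mxE -scalemxAr -scalemxAl [X in _ + X]mxE.
(* The order on [C] is partial, so [a] must be real before it can be assumed negative; [e = 1] makes
   [a] a difference of nonnegative numbers. *)
have a_real : a \is Num.real.
  rewrite -(addrK k a) realB ?ger0_real//.
  by have := ak 1 ltr01 (lexx _); rewrite mul1r.
rewrite real_leNgt ?real0//; apply/negP => a_lt0.
have Na_le : - a <= k by rewrite -subr_ge0 opprK addrC -[k]mul1r ak.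
have k_gt0 : 0 < k by apply: lt_le_trans Na_le; rewrite oppr_gt0.
(* This [e] turns [a + e k] into [a / 2 < 0], a contradiction. *)
have e_gt0 : 0 < - a / (2 * k) by rewrite divr_gt0 ?oppr_gt0// mulr_gt0.
have e_le1 : - a / (2 * k) <= 1.
  rewrite ler_pdivrMr ?mulr_gt0// mul1r (le_trans Na_le)//.
  by rewrite -[leLHS]mul1r ler_wpM2r// ler1n.
have := ak _ e_gt0 e_le1.
have -> : a + - a / (2 * k) * k = a / 2 by field; rewrite gt_eqF.
by rewrite pmulr_lge0 ?invr_gt0// lt_geF.
Qed.

(** * Assembly with [X = diag(A, B)] *)

(** The square root is an abstract [s], constrained only on nonnegative arguments, so that a root
    defined through the real part can be substituted. *)
Lemma mxmonotone_chebyshev (C : numClosedFieldType) (f s : C -> C) (n : nat)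
    (A B : 'M[C]_n) :
  (forall x, f x \is Num.real) -> mxmonotone f ->
  (forall x, 0 <= x -> 0 <= s x) -> (forall x, 0 <= x -> s x ^+ 2 = x) ->
  psd A -> psd B ->
  psd (A *m mxfun f A + B *m mxfun f B -
    mxfun s (2^-1 *: (A + B)) *m (mxfun f A + mxfun f B)
      *m mxfun s (2^-1 *: (A + B))).
Proof.
move=> f_real f_mono s_ge0 sK pA pB.
have h_ge0 : 0 <= 2^-1 :> C by rewrite invr_ge0.
have hh : 2^-1 + 2^-1 = 1 :> C by field.
have VV := wcol_isometry n h_ge0 h_ge0 hh.
have pX := block_diag_psd pA pB.
have conc := mxmonotone_compress f_real f_mono pX VV.
have conv := mxmonotone_mulx_compress f_mono pX VV.
move: conc conv; rewrite !mxfun_block_diag// mulmx_block !mulmx0 !mul0mx.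
rewrite !addr0 !add0r !wcol_compress// -!scalerDr.
set M := 2^-1 *: (A + B); set S := mxfun s M => conc conv.
have pM : psd M by apply/psdZ/psdD.
have hS : S^t* = S by apply/hermsymmxP/psd_herm/mxfun_psd.
(* All factors are functions of [M], and [x * f x = s x * f x * s x] for [x >= 0]. *)
have MfM : M *m mxfun f M = S *m mxfun f M *m S.
  rewrite -{1}[M]mxfun_id ?psd_herm// !mxfunM ?psd_herm//.
  by apply: mxfun_eq => // x x_ge0; rewrite -{1}[x]sK//; ring.
have two_half : 2 * 2^-1 = 1 :> C by field.
(* Adding [conv] to the congruence of [conc] by [S] cancels [M f(M)]; the factor 2 clears the
   halves. *)
have := psdZ (ler0n _ 2) (psdD conv (psd_congr S conc)).
rewrite hS mulmxBr mulmxBl -MfM addrA subrK scalerBr -scalemxAr -scalemxAl.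
by rewrite 2!scalerA two_half 2!scale1r.
Qed.

Theorem theorem1 (R : realType) (n : nat) (hn : (1 <= n)%N)
    (A B : 'M[R[i]]_n) (hA : psdmx A) (hB : psdmx B)
    (f : R -> R) (hf : matrix_monotone f) :
  loewner_ge
    (A *m fun_mx f A + B *m fun_mx f B)
    (sqrt_mx (2^-1 *: (A + B)) *m (fun_mx f A + fun_mx f B)
       *m sqrt_mx (2^-1 *: (A + B))).
Proof.
have f_real (z : R[i]) : (f (complex.Re z))%:C%C \is Num.real.
  by rewrite complex_real.
(* Here [s] is the function behind [sqrt_mx]; a nonnegative [z] is real, so it is a true square root
   there. *)
have sqrt_ge0 (z : R[i]) : 0 <= z -> 0 <= (Num.sqrt (complex.Re z))%:C%C.
  by rewrite ler0c sqrtr_ge0.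
have sqrtK (z : R[i]) : 0 <= z -> (Num.sqrt (complex.Re z))%:C%C ^+ 2 = z.
  move=> z_ge0; have z_real := ger0_real z_ge0.
  by rewrite -rmorphXn /= sqr_sqrtr ?RRe_real// -lecR RRe_real.
exact: (mxmonotone_chebyshev f_real hf sqrt_ge0 sqrtK hA hB).
Qed.
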